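(* Let $q>0$, $q\ne1$, let $1\le k\le N$, and let $\lambda=(\lambda_1\ge\cdots\ge\lambda_N\ge0)$ be a signature of size $N$ with nonnegative coordinates. Then, as an identity of rational functions in $x_1,\dots,x_k$, $$\mathfrak X_\lambda(x_1,\dots,x_k;N,q)=\frac{\Delta_s(q,\dots,q^N)\,(q-1)^{k^2-k}(-1)^{\binom k2}}{\Delta_s(x_1,\dots,x_k,q,\dots,q^{N-k})}\;\det\bigl[(D^s_{q,i})^{j-1}\bigr]_{i,j=1}^k\prod_{i=1}^k\mathfrak X_\lambda(x_i;N,q)\frac{\Delta_s(x_i,q,\dots,q^{N-1})}{\Delta_s(q,\dots,q^N)},$$ where $D^s_{q,i}$ is the difference operator $$f(x)\mapsto\frac{f(qx)+f(q^{-1}x)-2f(x)}{(q-1)^2}$$ acting on the variable $x_i$, and the determinant operator acts on the product over $i$ to its right.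
   Context: Symplectic characters: for $\lambda_1\ge\cdots\ge\lambda_N\ge0$ integers, $$\chi_\lambda(x_1,\dots,x_N)=\frac{\det\bigl[x_i^{\lambda_j+N+1-j}-x_i^{-(\lambda_j+N+1-j)}\bigr]_{i,j=1}^N}{\det\bigl[x_i^{N+1-j}-x_i^{-N-1+j}\bigr]_{i,j=1}^N}.$$ The denominator is $$\Delta_s(x_1,\dots,x_N)=\det\bigl[x_i^{N-j+1}-x_i^{-N+j-1}\bigr]_{i,j=1}^N=\prod_i(x_i-x_i^{-1})\prod_{i<j}\bigl(x_i+x_i^{-1}-(x_j+x_j^{-1})\bigr).$$ The normalized symplectic character is $$\mathfrak X_\lambda(x_1,\dots,x_k;N,q)=\frac{\chi_\lambda(x_1,\dots,x_k,q,\dots,q^{N-k})}{\chi_\lambda(q,q^2,\dots,q^N)}.$$ The operators $D^s_{q,1},\dots,D^s_{q,k}$ commute, so the determinant is well defined. *)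

(* Defs.v *)
From mathcomp Require Import all_boot all_order all_algebra perm.
From mathcomp Require Import ring.
From mathcomp.multinomials Require Export mpoly.

Set Implicit Arguments.
Unset Strict Implicit.
Unset Printing Implicit Defensive.

Import GRing.Theory.
Local Open Scope ring_scope.

(* 'I_N starts at 0: its index j is the mathematical index j+1, so that the
   exponent N+1-j becomes the positive natural number N - j. *)

Section SymplecticCharacters.
Variable F : fieldType.

Definition symp_det N (m : 'I_N -> nat) (x : 'I_N -> F) : F :=
  \det (\matrix_(i < N, j < N) (x i ^+ m j - x i ^- m j)).

Definition Delta_s N (x : 'I_N -> F) : F := symp_det (fun j => N - j)%N x.

Definition symp_char N (lam : 'I_N -> nat) (x : 'I_N -> F) : F :=
  symp_det (fun j => lam j + (N - j))%N x / Delta_s x.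

(* (q, q^2, ..., q^N) *)
Definition qpoints N (q : F) : 'I_N -> F := fun i => q ^+ i.+1.

(* (x_1, ..., x_k, q, ..., q^(N-k)), for k <= N *)
Definition qextend k N (x : 'I_k -> F) (q : F) : 'I_N -> F :=
  fun i => if insub (val i) is Some j then x j else q ^+ (i - k).+1.

Definition norm_symp_char k N (lam : 'I_N -> nat) (x : 'I_k -> F) (q : F) : F :=
  symp_char lam (qextend x q) / symp_char lam (qpoints q).

End SymplecticCharacters.

Arguments qpoints {F} N q _.
Arguments qextend {F k} N x q _.

(* Leibniz determinant of a matrix of operators on V; products are compositions
   taken in the order of the rows, which is immaterial when the entries
   commute (as they do for Dsq, see Dsq_comm below). *)
Definition opdet (V : pzRingType) k (M : 'I_k -> 'I_k -> V -> V) (f : V) : V :=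
  \sum_(s : 'S_k) (-1) ^+ s * (\big[comp/id]_(i < k) M i (s i)) f.

Section DifferenceOperator.
Variables (K : fieldType) (k : nat).
Local Notation P := {mpoly K[k]}.
Local Notation RF := {fraction P}.

Definition ratC (c : K) : RF := FracField.tofrac (c%:MP : P).
Definition ratX (i : 'I_k) : RF := FracField.tofrac ('X_i : P).

(* p(x_1, ..., c x_i, ..., x_k) *)
Definition mscale (i : 'I_k) (c : K) (p : P) : P :=
  p \mPo [tuple (if j == i then c *: 'X_j else 'X_j) | j < k].

(* f(x_1, ..., c x_i, ..., x_k), for c != 0, computed on the representative
   fraction of f chosen by [repr]; any other one gives the same result
   (qshift_frac). *)
Definition qshift (i : 'I_k) (c : K) (f : RF) : RF :=
  FracField.tofrac (mscale i c \n_(repr f)) /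
  FracField.tofrac (mscale i c \d_(repr f)).

Definition Dsq (q : K) (i : 'I_k) (f : RF) : RF :=
  (qshift i q f + qshift i q^-1 f - f *+ 2) / ratC ((q - 1) ^+ 2).

Implicit Types (c a d q : K) (f : RF).

Lemma mscaleX i c (j : 'I_k) :
  mscale i c 'X_j = if j == i then c *: 'X_j else 'X_j.
Proof. by rewrite /mscale comp_mpolyXU -tnth_nth tnth_mktuple. Qed.

Lemma mscaleC i c a : mscale i c a%:MP = a%:MP.
Proof. exact: comp_mpolyC. Qed.

Lemma mscale_comp i c j d (p : P) :
  mscale i c (mscale j d p) =
  p \mPo [tuple mscale i c (mscale j d 'X_l) | l < k].
Proof.
rewrite [in LHS]/mscale (comp_mpolyEX p) raddf_sum [RHS]comp_mpolyEX /=.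
apply: eq_bigr => m _; rewrite comp_mpolyZ; congr (_ *: _).
rewrite !comp_mpolyX rmorph_prod; apply: eq_bigr => l _ /=.
by rewrite rmorphXn /= !tnth_mktuple mscaleX.
Qed.

Lemma mscaleZ i c a (p : P) : mscale i c (a *: p) = a *: mscale i c p.
Proof. exact: comp_mpolyZ. Qed.

Lemma mscale_comm i c j d (p : P) :
  mscale i c (mscale j d p) = mscale j d (mscale i c p).
Proof.
rewrite !mscale_comp; congr (p \mPo _); apply: eq_mktuple => l.
rewrite !mscaleX.
rewrite !(fun_if (mscale _ _)) !mscaleZ !mscaleX.
by case: (l == j); case: (l == i); rewrite // !scalerA mulrC.
Qed.

Lemma mscaleK i c : c != 0 -> cancel (mscale i c) (mscale i c^-1).
Proof.
move=> c0 p; rewrite mscale_comp -[RHS]comp_mpoly_id; congr (p \mPo _).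
apply: eq_mktuple => l; rewrite mscaleX.
case: ifP => li; rewrite ?mscaleZ mscaleX li //.
by rewrite scalerA divff // scale1r.
Qed.

Lemma mscale_eq0 i c (p : P) : c != 0 -> (mscale i c p == 0) = (p == 0).
Proof.
move=> c0; apply/eqP/eqP => [p0|->]; last exact: comp_mpoly0.
by rewrite -(mscaleK i c0 p) p0; exact: comp_mpoly0.
Qed.

Lemma repr_frac (f : RF) :
  f = FracField.tofrac \n_(repr f) / FracField.tofrac \d_(repr f).
Proof.
elim/quotW: f => r; set s := repr _.
have rs : \n_r * \d_s = \d_r * \n_s by rewrite FracField.equivf_r.
have d0 : FracField.tofrac \d_s != 0 by rewrite tofrac_eq0 denom_ratioP.
apply: (canRL (mulfK d0)); unlock FracField.tofrac.
rewrite -[LHS]FracField.pi_mul; apply/eqmodP.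
rewrite /= FracField.equivfE /FracField.mulf /=.
by rewrite !numden_Ratio ?mulr1 ?oner_eq0 ?denom_ratioP ?rs.
Qed.

Lemma qshift_frac i c (n d : P) : c != 0 -> d != 0 ->
  qshift i c (FracField.tofrac n / FracField.tofrac d) =
  FracField.tofrac (mscale i c n) / FracField.tofrac (mscale i c d).
Proof.
move=> c0 d0; rewrite /qshift.
set f := FracField.tofrac n / FracField.tofrac d.
have := repr_frac f; move: (denom_ratioP (repr f)).
move: (\n_(repr f)) (\d_(repr f)) => n' d' d'0 /eqP.
rewrite /f eqr_div ?tofrac_eq0 // -!tofracM tofrac_eq => /eqP E.
apply/eqP; rewrite eqr_div ?tofrac_eq0 ?mscale_eq0 // -!tofracM tofrac_eq.
by rewrite /mscale -!rmorphM /= E.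
Qed.

Lemma fracP (f : RF) :
  exists n d : P, d != 0 /\ f = FracField.tofrac n / FracField.tofrac d.
Proof.
by exists \n_(repr f), \d_(repr f); rewrite denom_ratioP -repr_frac.
Qed.

Lemma qshiftD i c : c != 0 -> {morph qshift i c : f g / f + g}.
Proof.
move=> c0 f g; have [n [d [d0 ->]]] := fracP f.
have [n' [d' [d'0 ->]]] := fracP g.
rewrite addf_div ?tofrac_eq0 // -!tofracM -tofracD.
rewrite !qshift_frac ?mulf_neq0 // addf_div ?tofrac_eq0 ?mscale_eq0 //.
by rewrite /mscale -!tofracM -tofracD !rmorphM rmorphD !rmorphM.
Qed.

Lemma qshiftM i c : c != 0 -> {morph qshift i c : f g / f * g}.
Proof.
move=> c0 f g; have [n [d [d0 ->]]] := fracP f.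
have [n' [d' [d'0 ->]]] := fracP g.
rewrite mulf_div -!tofracM !qshift_frac ?mulf_neq0 // mulf_div.
by rewrite /mscale -!tofracM !rmorphM.
Qed.

Lemma qshift_tofrac i c (p : P) : c != 0 ->
  qshift i c (FracField.tofrac p) = FracField.tofrac (mscale i c p).
Proof.
move=> c0; rewrite -[X in qshift _ _ X]divr1 -tofrac1 qshift_frac ?oner_eq0 //.
by rewrite /mscale rmorph1 tofrac1 divr1.
Qed.

Lemma qshiftX i c j : c != 0 ->
  qshift i c (ratX j) = if j == i then ratC c * ratX j else ratX j.
Proof.
move=> c0; rewrite qshift_tofrac // mscaleX.
by case: ifP => // _; rewrite -tofracM mul_mpolyC.
Qed.

Lemma qshiftC i c a : c != 0 -> qshift i c (ratC a) = ratC a.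
Proof. by move=> c0; rewrite qshift_tofrac // mscaleC. Qed.

Lemma qshift_comm i c j d f : c != 0 -> d != 0 ->
  qshift i c (qshift j d f) = qshift j d (qshift i c f).
Proof.
move=> c0 d0; have [n [e [e0 ->]]] := fracP f.
rewrite !qshift_frac ?mscale_eq0 //.
by rewrite (mscale_comm i c j d n) (mscale_comm i c j d e).
Qed.

Lemma Dsq_comm q i j f : q != 0 -> Dsq q i (Dsq q j f) = Dsq q j (Dsq q i f).
Proof.
move=> q0; have q'0 : q^-1 != 0 by rewrite invr_eq0.
have ratC0 : ratC 0 = 0 by rewrite /ratC mpolyC0 tofrac0.
have invC a : (ratC a)^-1 = ratC a^-1.
  have [->|a0] := eqVneq a 0; first by rewrite [in RHS]invr0 ratC0 invr0.
  have ra0 : ratC a != 0 by rewrite tofrac_eq0 mpolyC_eq0.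
  by apply: (mulIf ra0); rewrite mulVf // -tofracM -mpolyCM mulVf // tofrac1.
have N c l g : c != 0 -> qshift l c (- g) = - qshift l c g.
  move=> c0; rewrite -mulN1r qshiftM // -[-1 in LHS]/(- (1 : RF)).
  have -> : -1 = ratC (-1) :> RF by rewrite /ratC mpolyCN tofracN tofrac1.
  by rewrite qshiftC // /ratC mpolyCN tofracN tofrac1 mulN1r.
have E c l m : c != 0 -> qshift l c (Dsq q m f) =
    (qshift l c (qshift m q f) + qshift l c (qshift m q^-1 f)
     - (qshift l c f + qshift l c f)) * ratC ((q - 1) ^+ 2)^-1.
  move=> c0; rewrite /Dsq invC mulr2n qshiftM // qshiftC //.
  by rewrite qshiftD // qshiftD // N // qshiftD.
have {}E l m : Dsq q l (Dsq q m f) = _ := congr1 (fun g => g * _)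
  (congr1 (fun g => g - _) (congr2 +%R (E q l m q0) (E q^-1 l m q'0))).
have ring_eq (F : fieldType) (w1 w2 w3 w4 a b c d e x y : F) :
  ((w1 + w2 - (a + a)) * x + (w3 + w4 - (b + b)) * x
    - (c + d - e *+ 2) * x *+ 2) * y =
  ((w1 + w3 - (c + c)) * x + (w2 + w4 - (d + d)) * x
    - (a + b - e *+ 2) * x *+ 2) * y by ring.
rewrite (E i j) (E j i) /Dsq invC.
rewrite (qshift_comm j i f q0 q0) (qshift_comm j i f q0 q'0).
rewrite (qshift_comm j i f q'0 q0) (qshift_comm j i f q'0 q'0).
exact: ring_eq.
Qed.

End DifferenceOperator.

(* Main.v *)
(* Put mu_j = lam_j + N + 1 - j and let v(y) be the row of the y^mu_j - y^-mu_j.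
   The rows v(q), ..., v(q^N) form an invertible matrix M; let w(y) be the
   coordinate row of v(y) in this basis.  The one-variable function on the
   right-hand side is, up to sign, the last entry of w.  Each entry of v is an
   eigenfunction of the difference operator, so (q - 1)^2 D acts on w as the
   matrix T = M diag(q^mu_j + q^-mu_j - 2) M^-1.  As
   (q^a)^m (q^m + q^-m) = q^((a+1)m) + q^((a-1)m), the matrix T has ones just
   above the diagonal and zeros further up, hence the last entries of
   w, w T, ..., w T^(k-1) are a unitriangular transform of the last k entries of
   w.  The determinant of those for w(x_1), ..., w(x_k) is, up to sign, the
   numerator of the left-hand side divided by det M. *)

Require Import Defs.
From HB Require Import structures.
From mathcomp Require Import all_boot all_order all_algebra perm.
From mathcomp Require Import ring zify.
Import GRing.Theory Num.Theory.
Local Open Scope ring_scope.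

Set Implicit Arguments.
Unset Strict Implicit.
Unset Printing Implicit Defensive.

(** * Binomial exponents and signs *)

Lemma bin2D k m : 'C(k + m, 2) = ('C(k, 2) + k * m + 'C(m, 2))%N.
Proof.
elim: k => [|k IHk]; first by rewrite bin0n.
by rewrite addSn !binS IHk !bin1; lia.
Qed.

Lemma sum_double_ord k : (\sum_(l < k) 2 * l = k ^ 2 - k)%N.
Proof.
elim: k => [|k IHk]; first by rewrite big_ord0.
by rewrite big_ord_recr /= IHk -!mulnn; nia.
Qed.

(** The two exponents differ by k(k - 1), which is even. This matches the sign of [symp_det_qextend]
    with the k signs (-1)^n coming from the one-variable factors. *)
Lemma sign_shuffle (R : pzRingType) n k : (k <= n.+1)%N ->
  (-1) ^+ ('C(k, 2) + k * (n.+1 - k)) = (-1) ^+ 'C(k, 2) * (-1) ^+ (n * k) :> R.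
Proof.
move=> kn; rewrite exprD -[in LHS](signr_odd _ (k * _)).
rewrite -[in RHS](signr_odd _ (n * k)).
by rewrite !oddM oddB //=; case: (odd n) (odd k) => -[].
Qed.

(** * Column reversal and powers of Hessenberg matrices *)

Section LinearAlgebra.
Variable F : fieldType.

Definition antidiag_mx n : 'M[F]_n := \matrix_(i, j) (i == rev_ord j)%:R.

Lemma mulmx_antidiag m n (A : 'M_(m, n)) i j :
  (A *m antidiag_mx n) i j = A i (rev_ord j).
Proof.
rewrite mxE (bigD1 (rev_ord j)) //= mxE eqxx mulr1 big1 ?addr0 // => l lj.
by rewrite mxE (negPf lj) mulr0.
Qed.

Lemma det_antidiag n : \det (antidiag_mx n) = (-1) ^+ 'C(n, 2).
Proof.
elim: n => [|n IHn]; first by rewrite det_mx00 bin0n.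
rewrite (expand_det_row _ ord0) (bigD1 ord_max) //= mxE big1 => [|j jmax].
  rewrite addr0 /cofactor add0n binS bin1 exprD mulrC.
  rewrite (_ : ord0 == _ = true) ?mulr1; last first.
    by apply/eqP/val_inj; rewrite /= subnn.
  rewrite mulrC; congr (_ * _); rewrite -IHn; congr (\det _).
  apply/matrixP => i j; rewrite !mxE; congr ((_ : bool)%:R).
  rewrite -!val_eqE /= /bump /=.
  by case: i => i /= ltin; case: j => j /= ltjn; lia.
rewrite mxE (_ : ord0 == _ = false) ?mul0r //.
by apply/negbTE; move: jmax; rewrite -!val_eqE /=; have := ltn_ord j; lia.
Qed.

(** Reversing the columns makes the matrix block upper triangular, with an antidiagonal block of
    size m at the bottom right. The signs of the two antidiagonal matrices, of sizes k + m and m,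
    combine through [bin2D]. *)
Lemma det_col_mx_pid k m (W : 'M[F]_(k, k + m)) :
  \det (col_mx W (pid_mx m)) =
  (-1) ^+ ('C(k, 2) + k * m) *
  \det (\matrix_(i < k, l < k) W i (rev_ord (lshift m l))).
Proof.
set W1 := \matrix_(i, l) _.
have E : col_mx W (pid_mx m) *m antidiag_mx (k + m) =
    block_mx W1 (\matrix_(i, j) W i (rev_ord (rshift k j))) 0 (antidiag_mx m).
  apply/matrixP => i j; rewrite mulmx_antidiag !mxE.
  case: splitP => a ia; rewrite !mxE; case: splitP => b jb; rewrite !mxE.
  - by congr (W _ _); apply: val_inj; rewrite /= jb.
  - by congr (W _ _); apply: val_inj; rewrite /= jb.
  - have := ltn_ord a; have := ltn_ord b.
    by rewrite /= jb; case: eqP => //=; lia.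
  - congr ((_ : bool)%:R); rewrite -val_eqE /= jb.
    by have := ltn_ord a; have := ltn_ord b; lia.
have := congr1 (fun A => \det A * (-1) ^+ 'C(k + m, 2)) E.
rewrite det_mulmx det_ublock !det_antidiag -mulrA -expr2 sqrr_sign mulr1 => ->.
by rewrite bin2D exprD mulrACA -expr2 sqrr_sign mulr1 mulrC.
Qed.

(** The entry is a sum over walks of [l] steps from [a] to the top index. A step climbs by at most
    one, with weight one if it does climb; when [a + l <= n], only the steadily climbing walk can
    arrive, and only if [a + l = n]. *)
Lemma unihessenberg_exp n (T : 'M[F]_n.+1) l (a : 'I_n.+1) :
  (forall i j : 'I_n.+1, (i < j)%N -> T i j = (j == i.+1 :> nat)%:R) ->
  (a + l <= n)%N -> (T ^+ l) a ord_max = (a + l == n)%N%:R.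
Proof.
move=> HT; elim: l a => [|l IHl] a al; first by rewrite expr0 mxE addn0.
have aS : (a.+1 < n.+1)%N by lia.
rewrite exprS mxE (bigD1 (Ordinal aS)) //= big1 => [|b ba].
  by rewrite HT //= eqxx mul1r addr0 IHl /= ?addSnnS // -addnS.
case: (ltnP a b) => ab.
  by rewrite HT // (_ : _ == _ = false) ?mul0r //; apply: negbTE.
have bl : (b + l < n)%N by move: ab al; clear; lia.
by rewrite IHl ?(ltnW bl) // (ltn_eqF bl) mulr0.
Qed.

(** By [unihessenberg_exp], the last column of [T ^+ l] vanishes above row n - l and has a one in
    that row. As l < k, only the last k columns of [W] matter; once their order is reversed, the
    transition matrix [U] is unitriangular. *)
Lemma det_krylov n k (leKn : (k <= n.+1)%N) (T : 'M[F]_n.+1)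
    (W : 'M_(k, n.+1)) :
  (forall i j : 'I_n.+1, (i < j)%N -> T i j = (j == i.+1 :> nat)%:R) ->
  \det (\matrix_(i < k, l < k) (W *m T ^+ l) i ord_max) =
  \det (\matrix_(i < k, l < k) W i (rev_ord (widen_ord leKn l))).
Proof.
move=> HT; pose r l := rev_ord (widen_ord leKn l).
pose U := \matrix_(b < k, l < k) (T ^+ l) (r b) ord_max.
have -> : \matrix_(i < k, l < k) (W *m T ^+ l) i ord_max =
    (\matrix_(i < k, l < k) W i (r l)) *m U.
  apply/matrixP => i l; rewrite !mxE (reindex_inj rev_ord_inj) /=.
  rewrite (bigID (fun b : 'I_n.+1 => b < k)%N) /= big_ord_narrow addrC.
  rewrite big1 => [|b].
    by rewrite add0r; apply: eq_bigr => b _; rewrite !mxE.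
  rewrite -leqNgt => kb; have := ltn_ord l; have := ltn_ord b => bn lk.
  have bl : (n.+1 - b.+1 + l < n)%N by lia.
  by rewrite unihessenberg_exp //= ?(ltnW bl) // (ltn_eqF bl) mulr0.
have trigU : is_trig_mx U^T.
  apply/is_trig_mxP => l b lb; rewrite !mxE.
  have := ltn_ord b => bk.
  have bl : (n.+1 - b.+1 + l < n)%N by lia.
  by rewrite unihessenberg_exp //= ?(ltnW bl) // (ltn_eqF bl).
rewrite det_mulmx -(det_tr U) (det_trig trigU) big1 ?mulr1 // => l _.
have := ltn_ord l => lk.
have ll : (n.+1 - l.+1 + l = n)%N by lia.
by rewrite !mxE unihessenberg_exp //= ll ?eqxx.
Qed.

End LinearAlgebra.

(** * Symplectic determinants and coordinates in the basis v(q), ..., v(q^N) *)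

Section SymplecticDeterminants.
Variable F : fieldType.

(* Multiplying a linear combination of the functions [y^e - y^-e] by [y^N] gives
   a polynomial of degree at most [2N] which vanishes at the [2N+1] points
   [1], [z j] and [1 / z j]. *)
Lemma det_symp_neq0 N (e : 'I_N -> nat) (z : 'I_N -> F) :
  injective e -> (forall i, 0 < e i <= N)%N ->
  uniq (1 :: codom z ++ codom (fun j => (z j)^-1)) -> (forall j, z j != 0) ->
  \det (\matrix_(i, j) (z j ^+ e i - z j ^- e i)) != 0.
Proof.
move=> e_inj e_le uniq_z z_neq0; set A := \matrix_(i, j) _.
rewrite -unitfE -[_ \is a _]/(A \in unitmx) -row_free_unit.
rewrite -kermx_eq0; apply/rowV0P => u /sub_kermxP uA.
pose p := \sum_i u 0 i *: ('X^(N + e i) - 'X^(N - e i)) : {poly F}.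
have pE y : p.[y] = \sum_i u 0 i * (y ^+ (N + e i) - y ^+ (N - e i)).
  by rewrite horner_sum; apply: eq_bigr => i _; rewrite !hornerE.
have p0 : p = 0.
  apply: (roots_geq_poly_eq0 _ uniq_z).
    have pz j : p.[z j] = 0.
      have := congr1 (fun B : 'rV_N => B 0 j) uA; rewrite !mxE => uAj.
      rewrite -[RHS](mulr0 (z j ^+ N)) -uAj mulr_sumr pE.
      apply: eq_bigr => i _.
      have [_ eN] := andP (e_le i).
      by rewrite mxE exprD expfB_cond ?(negPf (z_neq0 j)) //; ring.
    have pV j : p.[(z j)^-1] = 0.
      have := congr1 (fun B : 'rV_N => B 0 j) uA; rewrite !mxE => uAj.
      (* The functions y^e - y^-e change sign when y is inverted, hence the minus sign. *)
      rewrite -[RHS](mulr0 (- z j ^- N)) -uAj mulr_sumr pE.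
      apply: eq_bigr => i _.
      have [_ eN] := andP (e_le i).
      rewrite mxE exprD expfB_cond ?invr_eq0 ?(negPf (z_neq0 j)) //.
      rewrite !exprVn invrK.
      ring.
    apply/allP => y; rewrite inE mem_cat.
    case/or3P => [/eqP->|/codomP[j ->]|/codomP[j ->]].
    - by rewrite /root pE big1 // => i _; rewrite !expr1n subrr mulr0.
    - by rewrite /root pz.
    - by rewrite /root pV.
  rewrite /= size_cat !size_codom card_ord.
  apply: (leq_trans (size_sum _ _ _)); apply/bigmax_leqP => i _.
  have [_ eN] := andP (e_le i).
  apply: (leq_trans (size_scale_leq _ _)); apply: (leq_trans (size_polyD _ _)).
  by rewrite size_polyN !size_polyXn geq_max; lia.
(* The coefficient of degree N + e i in p is u_i: injectivity of [e] rules out the other N + e j,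
   and every N - e j is smaller because [e] is positive. *)
apply/rowP => i; rewrite mxE.
have := congr1 (fun r : {poly F} => r`_(N + e i)) p0; rewrite coef0 coef_sum.
have /andP[ei0 eN] := e_le i.
rewrite (bigD1 i) //= coefZ coefB !coefXn eqxx.
rewrite (_ : _ == _ = false); last by lia.
rewrite subr0 mulr1 big1 ?addr0 // => j ji; rewrite coefZ coefB !coefXn.
have -> : (N + e i == N + e j)%N = false.
  by rewrite eqn_add2l (inj_eq e_inj) eq_sym; apply: negbTE.
by rewrite (_ : _ == _ = false) ?subrr ?mulr0 //; lia.
Qed.

Lemma Delta_s_neq0 N (z : 'I_N -> F) :
  uniq (1 :: codom z ++ codom (fun j => (z j)^-1)) -> (forall j, z j != 0) ->
  Delta_s z != 0.
Proof.
move=> uniq_z z0; rewrite /Delta_s /symp_det -det_tr.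
have -> : (\matrix_(i < N, j < N) (z i ^+ (N - j) - z i ^- (N - j)))^T =
    \matrix_(i < N, j < N) (z j ^+ (N - i) - z j ^- (N - i)).
  by apply/matrixP => i j; rewrite !mxE.
apply: (@det_symp_neq0 _ (fun i : 'I_N => N - i)%N) => // [i j ij|i].
  by apply: val_inj; move: ij (ltn_ord i) (ltn_ord j) => /=; lia.
by have := ltn_ord i; lia.
Qed.

(** This is the row v(y) of the overview; [symp_qmx] is the matrix M and [symp_coord] the coordinate
    row w(y), with [m] in the role of mu. *)
Definition symp_row N (m : 'I_N -> nat) (y : F) : 'rV_N :=
  \row_j (y ^+ m j - y ^- m j).

Definition symp_qmx N (m : 'I_N -> nat) (q : F) : 'M_N :=
  \matrix_(i, j) (q ^+ i.+1 ^+ m j - q ^+ i.+1 ^- m j).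

Definition symp_coord N (m : 'I_N -> nat) (q y : F) : 'rV_N :=
  symp_row m y *m invmx (symp_qmx m q).

(** For a > 0 the row v(q^a) is a row of M, so its coordinates form a unit vector. The case a = 0,
    where v(1) = 0, serves the first row of T. *)
Lemma symp_coord_exp N (m : 'I_N -> nat) q a j :
  symp_qmx m q \in unitmx -> (a <= N)%N ->
  symp_coord m q (q ^+ a) 0 j = (a == j.+1)%:R.
Proof.
case: a => [_ _|a Mu aN].
  rewrite /symp_coord (_ : symp_row _ _ = 0) ?mul0mx ?mxE //.
  by apply/rowP => l; rewrite !mxE !expr1n invr1 subrr.
rewrite /symp_coord (_ : symp_row _ _ = row (Ordinal aN) (symp_qmx m q)).
  by rewrite -row_mul mulmxV // !mxE -val_eqE /= eqSS.
by apply/rowP => l; rewrite !mxE.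
Qed.

(** Factor M out on the right: the rows of the variables become w(x_i), and the rows of q, ...,
    q^(N-k) become the first N - k unit vectors, so [det_col_mx_pid] applies. *)
Lemma symp_det_qextend k N (leKN : (k <= N)%N) (m : 'I_N -> nat)
    (x : 'I_k -> F) q :
  symp_qmx m q \in unitmx ->
  symp_det m (qextend N x q) =
  (-1) ^+ ('C(k, 2) + k * (N - k)) *
  \det (\matrix_(i < k, l < k)
          symp_coord m q (x i) 0 (rev_ord (widen_ord leKN l))) *
  symp_det m (qpoints N q).
Proof.
move=> Mu; rewrite /symp_det -/(symp_qmx m q).
have [n NE] : exists n, N = (k + n)%N by exists (N - k)%N; lia.
subst N; rewrite addKn.
have -> : \matrix_(i, j) (qextend (k + n) x q i ^+ m j -
      qextend (k + n) x q i ^- m j) =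
    col_mx (\matrix_i symp_coord m q (x i)) (pid_mx n) *m symp_qmx m q.
  apply/row_matrixP => i; rewrite row_mul.
  have -> : row i (\matrix_(i, j) (qextend (k + n) x q i ^+ m j -
       qextend (k + n) x q i ^- m j)) = symp_row m (qextend (k + n) x q i).
    by apply/rowP => j; rewrite !mxE.
  apply: (canRL (mulmxKV Mu)); rewrite -/(symp_coord _ _ _).
  case: (split_ordP i) => a ->.
    rewrite rowKu rowK; congr (symp_coord _ _ _).
    by rewrite /qextend /= insubT // => ak; congr x; apply: val_inj.
  rewrite rowKd; apply/rowP => j; rewrite /qextend insubF /=; last by lia.
  rewrite addKn symp_coord_exp // ?mxE ?eqSS; last by have := ltn_ord a; lia.
  by rewrite ltn_ord andbT.
rewrite det_mulmx det_col_mx_pid -!mulrA; congr (_ * (\det _ * _)).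
apply/matrixP => i l; rewrite [LHS]mxE [RHS]mxE [LHS]mxE.
congr (symp_coord _ _ _ _ _).
exact: val_inj.
Qed.

(** All the points are integer powers of q, with the distinct exponents 0, m j and - m j. *)
Lemma uniq_exp_codom N (m : 'I_N -> nat) (q : F) :
  injective (exprz q) -> injective m -> (forall j, 0 < m j)%N ->
  uniq (1 :: codom (fun j => q ^+ m j) ++ codom (fun j => (q ^+ m j)^-1)).
Proof.
move=> q_inj m_inj m_gt0.
have -> : 1 :: codom (fun j => q ^+ m j) ++ codom (fun j => (q ^+ m j)^-1) =
    [seq q ^ z | z <- 0 :: codom (fun j => (m j)%:Z)
                        ++ codom (fun j => - (m j)%:Z)].
  rewrite /= map_cat /codom /image_mem -!map_comp; congr (_ :: _ ++ _).
  by apply: eq_map => j /=; rewrite -invr_expz.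
have mZ_inj : injective (fun j => (m j)%:Z) by move=> a b [] /m_inj.
have mN_inj : injective (fun j => - (m j)%:Z).
  by move=> a b /eqP; rewrite eqr_opp => /eqP /mZ_inj.
rewrite (map_inj_uniq q_inj) cons_uniq cat_uniq mem_cat.
rewrite (map_inj_uniq mZ_inj) (map_inj_uniq mN_inj) !enum_uniq.
rewrite /= andbT negb_or.
apply/andP; split; first (apply/andP; split); apply/negP.
- by case/codomP => j; have := m_gt0 j; lia.
- by case/codomP => j; have := m_gt0 j; lia.
by case/hasP => _ /codomP[j ->] /codomP[l]; have := m_gt0 j; lia.
Qed.

(** Since (q^i)^m = (q^m)^i, points and exponents can be exchanged: the exponents become 1, ..., N
    and the points q^(m j), which puts the matrix in the range of [det_symp_neq0] however large [m]
    is. *)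
Lemma symp_qmx_unit N (m : 'I_N -> nat) q :
  q != 0 -> injective (exprz q) -> injective m -> (forall j, 0 < m j)%N ->
  symp_qmx m q \in unitmx.
Proof.
move=> q0 q_inj m_inj m_gt0; rewrite unitmxE unitfE.
have -> : symp_qmx m q =
    \matrix_(i, j) ((q ^+ m j) ^+ i.+1 - (q ^+ m j) ^- i.+1).
  by apply/matrixP => i j; rewrite !mxE exprAC.
apply: (@det_symp_neq0 _ (fun i : 'I_N => i.+1)).
- by move=> i j [] /val_inj.
- by move=> i; exact: ltn_ord.
- exact: uniq_exp_codom.
- by move=> j; rewrite expf_neq0.
Qed.

Lemma symp_qmx_hessenberg n (m : 'I_n.+1 -> nat) q (i j : 'I_n.+1) :
  q != 0 -> symp_qmx m q \in unitmx -> (i < j)%N ->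
  (symp_qmx m q *m diag_mx (\row_j (q ^+ m j + q ^- m j - 2)) *m
    invmx (symp_qmx m q)) i j = (j == i.+1 :> nat)%:R.
Proof.
move=> q0 Mu ij; set d := diag_mx _.
transitivity ((row i (symp_qmx m q *m d) *m invmx (symp_qmx m q)) 0 j).
  by rewrite -row_mul [RHS]mxE.
have -> : row i (symp_qmx m q *m d) =
    symp_row m (q ^+ i.+2) + symp_row m (q ^+ i) - 2 *: symp_row m (q ^+ i.+1).
  apply/rowP => l; rewrite row_mul mul_mx_diag !mxE.
  rewrite -!exprM !mulSn !exprD.
  have := expf_neq0 (m l) q0; have := expf_neq0 (i * m l)%N q0.
  move: (q ^+ m l) (q ^+ (i * m l)) => b a a0 b0.
  by field; rewrite a0.
rewrite mulmxBl mulmxDl -scalemxAl -!/(symp_coord _ _ _).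
rewrite mxE [X in X + _]mxE [X in _ + X]mxE [X in - X]mxE.
(* Because i < j, row i is not the last one, so q^(i+2) is still among the points q, ..., q^N. *)
have jn := ltn_ord j; have iSn : (i.+1 < n.+1)%N := leq_trans ij jn.
rewrite !symp_coord_exp ?(ltnW iSn) ?(ltnW (ltnW iSn)) // !eqSS.
rewrite (ltn_eqF ij) (ltn_eqF (ltnW ij : (i < j.+1)%N)).
by rewrite mulr0 subr0 addr0 eq_sym.
Qed.

End SymplecticDeterminants.

Lemma symp_det_qextend1 (F : fieldType) n (m : 'I_n.+1 -> nat) (q y : F) :
  symp_qmx m q \in unitmx ->
  symp_det m (qextend n.+1 (fun _ : 'I_1 => y) q) =
  (-1) ^+ n * symp_coord m q y 0 ord_max * symp_det m (qpoints n.+1 q).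
Proof.
move=> Mu; rewrite (symp_det_qextend (ltn0Sn n) _ Mu) det_mx11 mxE.
rewrite mul1n subn1; congr (_ * symp_coord _ _ _ _ _ * _).
by apply: val_inj; rewrite /= subn1.
Qed.

Lemma symp_eigenvalue (F : fieldType) (x b a d : F) : b != 0 -> x != 0 ->
  ((b * x - (b * x)^-1) * a + (b^-1 * x - (b^-1 * x)^-1) * a
    - (x - x^-1) * a *+ 2) / d =
  (x - x^-1) * ((b + b^-1 - 2) / d * a).
Proof.
by move=> b0 x0; rewrite !invfM invrK; move: d^-1 => d'; field; rewrite b0.
Qed.

(** * Difference operators acting on rational functions *)

HB.instance Definition _ (K : fieldType) (k : nat) :=
  GRing.RMorphism.copy (@ratC K k)
    (@FracField.tofrac {mpoly K[k]} \o @mpolyC k K).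

Section DifferenceOperator.
Variables (K : fieldType) (k : nat).
Local Notation RF := {fraction {mpoly K[k]}}.

(* The proof of [c != 0] is an argument so that HB can attach an unconditional
   morphism structure. *)
Definition qshift_morph i c of c != 0 : RF -> RF := qshift i c.

Fact qshift_is_zmod_morphism i c (c0 : c != 0) :
  zmod_morphism (qshift_morph i c0).
Proof.
move=> f g; rewrite /qshift_morph; apply: (addIr (qshift i c g)).
by rewrite -qshiftD // !subrK.
Qed.

Fact qshift_is_monoid_morphism i c (c0 : c != 0) :
  monoid_morphism (qshift_morph i c0).
Proof.
split; last exact: qshiftM.
by rewrite /qshift_morph -(rmorph1 (@ratC K k)) qshiftC.
Qed.

HB.instance Definition _ i c (c0 : c != 0) :=
  GRing.isZmodMorphism.Build RF RF (qshift_morph i c0)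
    (qshift_is_zmod_morphism i c0).
HB.instance Definition _ i c (c0 : c != 0) :=
  GRing.isMonoidMorphism.Build RF RF (qshift_morph i c0)
    (qshift_is_monoid_morphism i c0).

Lemma ratX_neq_ratC (i : 'I_k) (c : K) : ratX K i != ratC k c.
Proof.
rewrite /ratX /ratC tofrac_eq; apply/eqP => /(congr1 (fun p => msize p)).
by rewrite msizeX mdeg1 msizeC; case: (c == 0).
Qed.

Lemma ratX_neq0 (i : 'I_k) : ratX K i != 0.
Proof. by rewrite -(rmorph0 (@ratC K k)) ratX_neq_ratC. Qed.

(** The one-variable functions of the proof all have this form. The coefficients are constants, so
    shifts act on [y] alone and [Dsq] merely rescales each coefficient by an eigenvalue. *)
Definition symp_sum N (m : 'I_N -> nat) (a : 'I_N -> K) (y : RF) : RF :=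
  \sum_j (y ^+ m j - y ^- m j) * ratC k (a j).

Lemma qshift_symp_sum i c N (m : 'I_N -> nat) a y : c != 0 ->
  qshift i c (symp_sum m a y) = symp_sum m a (qshift i c y).
Proof.
move=> c0; rewrite -[qshift i c]/(qshift_morph i c0) rmorph_sum.
apply: eq_bigr => j _; rewrite rmorphM rmorphB fmorphV rmorphXn /=.
by rewrite [X in _ * X]qshiftC.
Qed.

Variable q : K.
Hypothesis q0 : q != 0.

Lemma Dsq_symp_sum i N (m : 'I_N -> nat) a :
  Dsq q i (symp_sum m a (ratX K i)) =
  symp_sum m (fun j => (q ^+ m j + q ^- m j - 2) / (q - 1) ^+ 2 * a j)
    (ratX K i).
Proof.
have q'0 : q^-1 != 0 by rewrite invr_eq0.
rewrite /Dsq !qshift_symp_sum // !qshiftX // eqxx.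
rewrite /symp_sum -big_split /= -sumrMnl -sumrB mulr_suml.
apply: eq_bigr => j _.
rewrite [in RHS]rmorphM fmorph_div rmorphB rmorphD fmorphV rmorph_nat.
rewrite fmorphV !rmorphXn /= !exprMn !exprVn.
have := expf_neq0 (m j) (ratX_neq0 i).
have : ratC k q ^+ m j != 0 by rewrite expf_neq0 // fmorph_eq0.
exact: symp_eigenvalue.
Qed.

Lemma iter_Dsq_fixed i n (f g : RF) :
  (forall c, c != 0 -> qshift i c g = g) ->
  iter n (Dsq q i) (f * g) = iter n (Dsq q i) f * g.
Proof.
move=> g_fix; elim: n => //= n ->; rewrite /Dsq !qshiftM ?invr_eq0 //.
by rewrite !g_fix ?invr_eq0 //; ring.
Qed.

(** The shifts of x_i fix every factor except the i-th, so each Leibniz term acts factor by factor,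
    and the l-th iterate turns [h i 0] into [h i l]. *)
Lemma opdet_Dsq_prod (h : 'I_k -> nat -> RF) :
  (forall i n, Dsq q i (h i n) = h i n.+1) ->
  (forall i j n c, c != 0 -> j != i -> qshift i c (h j n) = h j n) ->
  opdet (fun i j : 'I_k => iter j (Dsq q i)) (\prod_(i < k) h i 0%N) =
  \det (\matrix_(i < k, j < k) h i j).
Proof.
move=> Dh h_fix; apply: eq_bigr => s _; congr (_ * _).
under [RHS]eq_bigr do rewrite mxE.
have iterE i n : iter n (Dsq q i) (h i 0%N) = h i n.
  by elim: n => //= n ->.
(* The induction runs over a duplicate-free list of variables already acted on; the remaining
   factors are still at exponent 0. *)
suff E r : uniq r ->
    (\big[comp/id]_(i <- r) iter (s i) (Dsq q i)) (\prod_i h i 0%N) =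
    \prod_i h i (if i \in r then s i : nat else 0%N).
  rewrite E ?index_enum_uniq //.
  by apply: eq_bigr => i _; rewrite mem_index_enum.
elim: r => [|i r IHr] /=; first by rewrite big_nil.
case/andP=> ir /IHr E; rewrite big_cons /= E (bigD1 i) //= (negPf ir).
rewrite iter_Dsq_fixed => [|c c0]; last first.
  rewrite -[qshift i c]/(qshift_morph i c0) rmorph_prod.
  by apply: eq_bigr => j ji; apply: h_fix.
rewrite iterE [RHS](bigD1 i) //= inE eqxx; congr (_ * _).
by apply: eq_bigr => j ji; rewrite inE (negPf ji).
Qed.

End DifferenceOperator.

(** * Distinct powers of q and nonvanishing denominators *)

Lemma exprz_inj (K : numFieldType) (q : K) :
  0 < q -> q != 1 -> injective (exprz q).
Proof.
move=> q_gt0 q1 a b qab; have q0 := lt0r_neq0 q_gt0.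
have expn_eq1 n : q ^+ n = 1 -> n = 0%N.
  by rewrite -(expr0 q); apply: ieexprIn.
have : q ^ (a - b) = 1 by rewrite expfzDr // qab -expfzDr // subrr.
case E : (a - b) => [n|n].
  by move/expn_eq1 => n0; apply/eqP; rewrite -subr_eq0 E n0.
by rewrite NegzE -invr_expz => /(canRL (@invrK _)); rewrite invr1 => /expn_eq1.
Qed.

Section QPoints.
Variables (K : fieldType) (k N : nat) (q : K).
Hypotheses (q0 : q != 0) (q_inj : injective (exprz q)).

Lemma Delta_s_qpoints_neq0 : Delta_s (qpoints N q) != 0.
Proof.
rewrite /Delta_s /symp_det -unitfE -[_ \is a _]unitmxE.
apply: symp_qmx_unit => // [i j ij|j]; last by have := ltn_ord j; lia.
by apply: val_inj; move: ij (ltn_ord i) (ltn_ord j) => /=; lia.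
Qed.

(** Neither x nor 1/x is a constant, and x = 1/x would force x to be 1 or -1; the other points are
    distinct powers of q. *)
Lemma Delta_s_qextend1_neq0 (i : 'I_k) :
  Delta_s (qextend N (fun _ : 'I_1 => ratX K i) (ratC k q)) != 0.
Proof.
case: N => [|n]; first by rewrite /Delta_s /symp_det det_mx00 oner_eq0.
set z := qextend _ _ _; set x := ratX K i.
have z0 : z ord0 = x by rewrite /z /qextend insubT.
have zS (j : 'I_n) : z (lift ord0 j) = ratC k (q ^+ j.+1).
  by rewrite /z /qextend insubF //= subn1 rmorphXn.
have xC c : x = ratC k c -> False by move/eqP; apply/negP/ratX_neq_ratC.
have xVC c : x^-1 = ratC k c -> False.
  by move/(congr1 GRing.inv); rewrite invrK -fmorphV; apply: xC.
apply: Delta_s_neq0 => [|j]; last first.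
  case: (unliftP ord0 j) => [l ->|->]; last by rewrite z0 ratX_neq0.
  by rewrite zS fmorph_eq0 expf_neq0.
have -> : codom z = x :: map (ratC k) (codom (fun j : 'I_n => q ^+ j.+1)).
  rewrite /codom /image_mem enum_ordSl /= z0 -!map_comp; congr (_ :: _).
  by apply: eq_map => j; apply: zS.
have -> : codom (fun j => (z j)^-1) =
    x^-1 :: map (ratC k) (codom (fun j : 'I_n => (q ^+ j.+1)^-1)).
  rewrite /codom /image_mem enum_ordSl /= z0 -!map_comp; congr (_ :: _).
  by apply: eq_map => j /=; rewrite zS fmorphV.
set A := codom _; set B := codom _.
have /perm_uniq -> : perm_eq
    (1 :: (x :: map (ratC k) A) ++ x^-1 :: map (ratC k) B)
    (x :: x^-1 :: map (ratC k) (1 :: A ++ B)).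
  apply/seq.permP => P; rewrite /= !count_cat /= map_cat count_cat rmorph1.
  by move: (P 1) (P x) (P x^-1) (count P _) (count P _) => ? ? ? ? ?; lia.
rewrite cons_uniq inE negb_or cons_uniq (map_inj_uniq (fmorph_inj _)).
rewrite uniq_exp_codom // ?andbT; last by move=> a b [] /val_inj.
rewrite -andbA; apply/and3P; split; apply/negP.
- move/eqP => xx; have : x ^+ 2 == 1 by rewrite expr2 {2}xx divff ?ratX_neq0.
  rewrite sqrf_eq1 => /orP[]/eqP.
    by rewrite -(rmorph1 (ratC k)); apply: xC.
  by rewrite -(rmorphN1 (ratC k)); apply: xC.
- by case/mapP => c _; apply: xC.
- by case/mapP => c _; apply: xVC.
Qed.

End QPoints.

(** * Assembly of the identity *)

Lemma krylov_symp_coord (F : fieldType) n (m : 'I_n.+1 -> nat) (q y : F) l :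
  let M := symp_qmx m q in
  M \in unitmx ->
  (symp_coord m q y *m
    (M *m diag_mx (\row_j (q ^+ m j + q ^- m j - 2)) *m invmx M) ^+ l)
      0 ord_max =
  \sum_j (y ^+ m j - y ^- m j) *
    ((q ^+ m j + q ^- m j - 2) ^+ l * invmx M j ord_max).
Proof.
move=> M Mu; set d := diag_mx _; rewrite /symp_coord -mulmxA mxE.
apply: eq_bigr => j _; rewrite mxE; congr (_ * _).
(* What remains is the last column of M^-1 T^l = d^l M^-1, which holds because T = M d M^-1. *)
elim: l j => [|l IHl] j; first by rewrite !expr0 mul1r mulmx1.
rewrite exprS mulmxA !mulmxA mulVmx // mul1mx -mulmxA mul_diag_mx mxE IHl.
by rewrite mxE exprS mulrA.
Qed.

Lemma single_variable_ratio (F : fieldType) (A D D1 c s : F) :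
  A != 0 -> D != 0 -> D1 != 0 ->
  s * c * A / D1 / (A / D) * (D1 / D) = c * s.
Proof. by move=> A0 D0 D10; field; rewrite A0 D0. Qed.

(** In the application [A] and [D] are the numerator and denominator determinants at q, ..., q^N,
    [X] is the denominator at the variables, [E] is (Q - 1)^(k^2 - k), and [c] is the determinant of
    coordinates. *)
Lemma multi_variable_ratio (F : fieldType) (A D E X c s1 s2 : F) :
  A != 0 -> D != 0 -> E != 0 ->
  s1 * s2 * c * A / X / (A / D) = D * E * s1 / X * (c * (s2 / E)).
Proof. by move=> A0 D0 E0; move: X^-1 => X'; field; rewrite A0 D0 E0. Qed.

Theorem theorem3p14 (K : numFieldType) (q : K) (k N : nat) (lam : 'I_N -> nat) :
  0 < q -> q != 1 -> (1 <= k)%N -> (k <= N)%N ->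
  (forall i j : 'I_N, (i <= j)%N -> (lam j <= lam i)%N) ->
  let x := @ratX K k in
  let Q := @ratC K k q in
  norm_symp_char lam x Q =
    Delta_s (qpoints N Q) * (Q - 1) ^+ (k ^ 2 - k) * (-1) ^+ 'C(k, 2)
    / Delta_s (qextend N x Q)
    * opdet (fun i j : 'I_k => iter j (Dsq q i))
        (\prod_(i < k)
           (norm_symp_char lam (fun _ : 'I_1 => x i) Q *
            (Delta_s (qextend N (fun _ : 'I_1 => x i) Q)
             / Delta_s (qpoints N Q)))).
Proof.
move=> q_gt0 q1 k_gt0 kN lam_decr x Q.
(* The successor form of N gives square matrices the ring structure used for [T ^+ l]. *)
case: N kN lam lam_decr => [|n] kN lam lam_decr; first by lia.
have q0 : q != 0 := lt0r_neq0 q_gt0.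
have q_inj : injective (exprz q) by apply: exprz_inj.
pose mu j := (lam j + (n.+1 - j))%N.
have mu_gt0 j : (0 < mu j)%N by rewrite /mu; have := ltn_ord j; lia.
have mu_inj : injective mu.
  move=> i j; rewrite /mu => E; apply: val_inj => /=.
  have := ltn_ord i; have := ltn_ord j.
  by case: (leqP i j) => [/[dup] ij|/[dup] ij /ltnW] /lam_decr; lia.
have MuK : symp_qmx mu q \in unitmx by apply: symp_qmx_unit.
have ME : symp_qmx mu Q = map_mx (ratC k) (symp_qmx mu q).
  by apply/matrixP => i j; rewrite !mxE rmorphB fmorphV !rmorphXn.
have Mu : symp_qmx mu Q \in unitmx by rewrite ME map_unitmx.
have Aq0 : symp_det mu (qpoints n.+1 Q) != 0.
  by rewrite -unitfE -[_ \is a _]unitmxE.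
have Dq0 : Delta_s (qpoints n.+1 Q) != 0.
  apply: Delta_s_qpoints_neq0; first by rewrite fmorph_eq0.
  by move=> a b; rewrite /= -!rmorphXz ?unitfE // => /fmorph_inj /q_inj.
(* Up to the sign from [symp_det_qextend1], [a] is the last column of M^-1. It is taken over K, so
   that the coefficients are constants; [e] lists the eigenvalues of the difference operator, and
   [h i l] is its l-th iterate on the i-th factor. *)
pose a j := (-1) ^+ n * invmx (symp_qmx mu q) j ord_max.
pose e j := (q ^+ mu j + q ^- mu j - 2) / (q - 1) ^+ 2.
pose h (i : 'I_k) l := symp_sum mu (fun j => e j ^+ l * a j) (x i).
have gE i : norm_symp_char lam (fun _ : 'I_1 => x i) Q *
   (Delta_s (qextend n.+1 (fun _ : 'I_1 => x i) Q) /
    Delta_s (qpoints n.+1 Q)) = h i 0%N.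
  have D1 := Delta_s_qextend1_neq0 n.+1 q0 q_inj i.
  have A1 := symp_det_qextend1 (x i) Mu.
  have cE : symp_coord mu Q (x i) 0 ord_max * (-1) ^+ n = h i 0%N.
    rewrite /symp_coord ME -map_invmx mxE mulr_suml; apply: eq_bigr => j _.
    rewrite !mxE -mulrA; congr (_ * _).
    by rewrite /a expr0 mul1r rmorphM rmorph_sign mulrC.
  rewrite /norm_symp_char /symp_char -/mu A1 -cE.
  exact: (single_variable_ratio _ _ Aq0 Dq0 D1).
under eq_bigr do rewrite gE.
rewrite opdet_Dsq_prod //; first last.
- move=> i j l c c0 ji; rewrite /h qshift_symp_sum //.
  by rewrite [qshift _ _ _]qshiftX // (negPf ji).
- move=> i l; rewrite /h Dsq_symp_sum //; apply: eq_bigr => j _.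
  by rewrite -/(e j) mulrA -exprS.
pose T := symp_qmx mu Q *m diag_mx (\row_j (Q ^+ mu j + Q ^- mu j - 2)) *m
   invmx (symp_qmx mu Q).
pose W := \matrix_(i < k) symp_coord mu Q (x i).
(* As T represents (q - 1)^2 D, column l differs from the Krylov column by (Q - 1)^(-2l), besides
   the sign (-1)^n. *)
have -> : \matrix_(i < k, j < k) h i j =
    \matrix_(i < k, l < k) (W *m T ^+ l) i ord_max *m
    diag_mx (\row_l ((-1) ^+ n * (Q - 1) ^- (2 * l))).
  apply/matrixP => i l; rewrite mul_mx_diag [LHS]mxE [RHS]mxE.
  rewrite [X in X * _]mxE [X in _ * X]mxE.
  have -> : (W *m T ^+ l) i ord_max =
      (symp_coord mu Q (x i) *m T ^+ l) 0 ord_max.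
    rewrite -[symp_coord _ _ _](rowK (fun i => symp_coord mu Q (x i))).
    by rewrite -row_mul [RHS]mxE.
  have KE := krylov_symp_coord (x i) l Mu.
  rewrite KE mulr_suml; apply: eq_bigr => j _; rewrite -mulrA; congr (_ * _).
  have eE : ratC k (e j) = (Q ^+ mu j + Q ^- mu j - 2) / (Q - 1) ^+ 2.
    rewrite /e fmorph_div !rmorphB rmorphD fmorphV !rmorphXn rmorph_nat.
    by rewrite rmorphB rmorph1.
  rewrite rmorphM rmorphXn /= eE expr_div_n -exprM ME -map_invmx.
  rewrite [X in _ = _ * X * _]mxE.
  rewrite /a rmorphM rmorph_sign.
  by rewrite mulrACA [_^-1 * _]mulrC [RHS]mulrACA.
have Q0 : Q != 0 by rewrite fmorph_eq0.
rewrite det_mulmx det_diag (det_krylov kN); last first.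
  by move=> i j ij; apply: (symp_qmx_hessenberg Q0 Mu ij).
have Q1 : Q - 1 != 0.
  by rewrite subr_eq0 -(rmorph1 (ratC k)) (inj_eq (fmorph_inj _)).
(* Summing 2l over l < k produces the exponent k^2 - k of the statement. *)
have -> : \prod_(l < k) (\row_l ((-1) ^+ n * (Q - 1) ^- (2 * l))) 0 l =
    (-1) ^+ (n * k) * (Q - 1) ^- (k ^ 2 - k) :> {fraction {mpoly K[k]}}.
  under eq_bigr do rewrite mxE.
  by rewrite big_split /= prodr_const card_ord -exprM prodfV prodrXr
    sum_double_ord.
have AE := symp_det_qextend kN x Mu.
rewrite /norm_symp_char /symp_char -/mu AE sign_shuffle //.
set D := \det _.
have -> : D = \det (\matrix_(i, l) W i (rev_ord (widen_ord kN l))).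
  by congr (\det _); apply/matrixP => i l; rewrite !mxE.
exact: (multi_variable_ratio _ _ _ _ Aq0 Dq0 (expf_neq0 _ Q1)).
Qed.
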